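(* Let $C \subset \mathbb{R}^{N}$ be a nonempty, closed, bounded and convex set with nonempty interior, and let $f \colon C \to \mathbb{R}^{N}$ be a continuous function. Suppose that there exists an outer normal field $\nu \colon \partial C \to \mathbb{S}^{N-1}$ such that $$\langle f(x), \nu(x) \rangle \leq 0, \quad \text{for all } x\in \partial C.$$ Then the differential equation $\dot{y} = f(y)$ has a constant solution in $C$, i.e. there exists $z\in C$ with $f(z)=0$.
   Context: $\langle\cdot,\cdot\rangle$ is the Euclidean inner product on $\mathbb{R}^N$, $\mathbb{S}^{N-1}$ is the Euclidean unit sphere of $\mathbb{R}^N$, and $\partial C$ is the boundary of $C$. For a convex set $C$, an outer normal field is a map $\nu \colon \partial C \to \mathbb{S}^{N-1}$ (not assumed continuous) such that $\langle u - x, \nu(x)\rangle \leq 0$ for all $x\in\partial C$ and all $u\in C$. *)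

(* Defs.v *)
From HB Require Import structures.
From mathcomp Require Import all_boot all_order all_algebra.
From mathcomp Require Import all_classical all_reals all_analysis.

Set Implicit Arguments.
Unset Strict Implicit.
Unset Printing Implicit Defensive.

Import Order.TTheory GRing.Theory Num.Theory.
Import numFieldNormedType.Exports.

Local Open Scope classical_set_scope.
Local Open Scope ring_scope.

(* R^N is 'rV[R]_N. The library norm on 'rV[R]_N is the sup norm: it is used
   only for the topology and for boundedness, which are the Euclidean ones. *)

Definition inner (R : realType) (N : nat) (u v : 'rV[R]_N) : R :=
  \sum_(i < N) u ord0 i * v ord0 i.

Definition unit_sphere (R : realType) (N : nat) : set 'rV[R]_N :=
  [set u | Num.sqrt (inner u u) = 1].

Definition boundary (T : topologicalType) (A : set T) : set T :=
  closure A `\` interior A.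

(* [nu] is a total function; only its values on the boundary matter. *)
Definition outer_normal_field (R : realType) (N : nat) (C : set 'rV[R]_N)
    (nu : 'rV[R]_N -> 'rV[R]_N) : Prop :=
  (forall x, boundary C x -> unit_sphere (nu x)) /\
  (forall x u, boundary C x -> C u -> inner (u - x) (nu x) <= 0).

(* [y] is a solution on the whole line of the autonomous equation y' = f(y)
   staying in [C], the domain of [f]. *)
Definition ode_solution_in (R : realType) (N : nat) (C : set 'rV[R]_N)
    (f : 'rV[R]_N -> 'rV[R]_N) (y : R -> 'rV[R]_N) : Prop :=
  forall t : R, C (y t) /\ is_derive t (1 : R) y (f (y t)).

(* Main.v *)
Require Import Defs.
From HB Require Import structures.
From mathcomp Require Import all_boot all_order all_algebra.
From mathcomp Require Import fingroup perm.

(** Let [r y = x0 + (y - x0) / q] be the radial retraction of the space onto [C]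
from an interior point [x0], where [q >= 1] is the gauge of [C] cut off below at
1. By the Poincare-Miranda theorem on a large box, [f (r y) + r y - y] vanishes
at some [p], that is [f (r p) = (q - 1) (r p - x0)]. If [q > 1], then [r p] is a
boundary point and [<r p - x0, nu (r p)> > 0] because [x0] is interior, which
contradicts the hypothesis on [f]; hence [q = 1] and [f (r p) = 0]. Because the
retraction is radial, a single normal vector at each boundary point suffices,
with no regularity of [nu].

Poincare-Miranda follows from a parity argument on the Kuhn triangulation of a
cubical grid. A pair (simplex, facet) is sent to the pair on the other side of
the facet; on the pairs whose facet carries all colors but the last one, this
involution has a single fixed point, because a grid point on an upper face is
colored by the least coordinate that is maximal there. The number of such pairs
is therefore odd, whereas a simplex missing a color contributes an even number
of them. *)

Set Implicit Arguments.
Unset Strict Implicit.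
Unset Printing Implicit Defensive.

(** * Sperner's lemma on a cubical grid *)

(** The points moved by [f] fall into pairs [{x, f x}]; the induction removes one such pair at a
    time. *)
Lemma odd_card_involution (T : finType) (A : {set T}) (f : T -> T) :
    {in A, forall x, f x \in A} -> {in A, forall x, f (f x) = x} ->
  odd #|A| = odd #|[set x in A | f x == x]|.
Proof.
move: {2}#|A| (leqnn #|A|) => n; elim: n A => [|n IHn] A leAn fA ffA.
  have ->: A = set0 by apply/eqP; rewrite -cards_eq0 -leqn0.
  by congr (odd _); apply: eq_card => x; rewrite !inE.
have [/forallP fixA|] := boolP [forall x, (x \in A) ==> (f x == x)].
  congr (odd _); apply: eq_card => x; rewrite inE.
  by have := fixA x; case: (x \in A) => //= ->.
rewrite negb_forall => /existsP[x]; rewrite negb_imply => /andP[Ax fxx].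
have AE : A = x |: (f x |: (A :\ x :\ f x)).
  apply/setP => y; rewrite !inE; case: eqVneq => [->//|yx] /=.
  by case: eqVneq => // ->; rewrite fA.
have cA : #|A| = #|A :\ x :\ f x|.+2.
  by rewrite [in LHS]AE !cardsU1 !inE eqxx negb_or eq_sym fxx /= eqxx.
rewrite cA /= negbK IHn.
- congr (odd _); apply: eq_card => y; rewrite !inE.
  have [->|yfx] /= := eqVneq y (f x).
    by rewrite ffA // eq_sym (negbTE fxx) andbF.
  by have [->|_] //= := eqVneq y x; rewrite (negbTE fxx) andbF.
- by move: leAn; rewrite cA ltnS => /ltnW.
- move=> y; rewrite !inE => /and3P[yfx yx Ay]; rewrite fA // andbT.
  apply/andP; split; last by apply: contraNneq yfx => <-; rewrite ffA.
  by apply: contraNneq yx => e; rewrite -(ffA y) // e ffA.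
- by move=> y; rewrite !inE => /and3P[_ _]; apply: ffA.
Qed.

Section ColoredSimplex.
Variables (n : nat) (c : 'I_n.+1 -> 'I_n.+1).

(** The facet opposite [k] has [n] vertices for the [n] colors below the last one, so each occurs
    exactly once there. *)
Definition rainbow_facet (k : 'I_n.+1) :=
  [forall j : 'I_n, [exists i, (i != k) && (c i == j :> nat)]].

(** One such facet forces the missing color to be the last. Then the color of its opposite vertex
    [k0] recurs at exactly one other vertex [k1], and precisely the facets opposite [k0] and [k1]
    qualify. *)
Lemma even_rainbow_facets :
    (exists j, forall i, c i != j) ->
  ~~ odd #|[set k | rainbow_facet k]|.
Proof.
case=> j0 cj0.
have [->|[k0]] := set_0Vmem [set k | rainbow_facet k]; first by rewrite cards0.
rewrite inE => Rk0.
have c_lt i : c i < n.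
  rewrite ltn_neqAle -ltnS ltn_ord andbT; apply/eqP => ci.
  have [jn|nj] := ltnP j0 n; last first.
    move: (cj0 i); rewrite -val_eqE /= ci eqn_leq nj.
    by rewrite -ltnS ltn_ord.
  have /forallP/(_ (Ordinal jn))/existsP[i' /andP[_ /eqP/= ci']] := Rk0.
  by move: (cj0 i'); rewrite -val_eqE /= ci' eqxx.
pose d i := Ordinal (c_lt i).
have dinj k : rainbow_facet k -> {in [set~ k] &, injective d}.
  move=> Rk; apply/imset_injP; rewrite cardsC1 card_ord /=.
  have ->: d @: [set~ k] = [set: 'I_n].
    apply/setP => j; rewrite inE; move/forallP: Rk => /(_ j)/existsP[i].
    case/andP=> ik /eqP ci; apply/imsetP; exists i; first by rewrite !inE.
    exact: val_inj.
  by rewrite cardsT card_ord.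
have dsame i k : rainbow_facet k -> d i = d k -> rainbow_facet i.
  move=> /forallP Rk dik; apply/forallP => j.
  have /existsP[l /andP[lk clj]] := Rk j.
  have [li|li] := eqVneq l i; last by apply/existsP; exists l; rewrite li.
  apply/existsP; exists k; rewrite -li eq_sym lk /=.
  by move/(congr1 val): dik => /= <-; rewrite -li.
have /forallP/(_ (d k0))/existsP[k1 /andP[k10 ck1]] := Rk0.
have dk10 : d k1 = d k0 by apply/val_inj/eqP.
have ->: [set k | rainbow_facet k] = [set k0; k1].
  apply/setP => k; rewrite !inE; apply/idP/idP; last first.
    by case/orP => /eqP->//; apply: dsame dk10.
  move=> Rk; apply: contraT; rewrite negb_or => /andP[kk0 kk1].
  by case/eqP: k10; apply: (dinj _ Rk) => //; rewrite !inE eq_sym.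
by rewrite cards2 eq_sym k10.
Qed.

End ColoredSimplex.

(** * Kuhn's triangulation of the cube *)

Section Kuhn.
Variables (n m : nat).
Local Notation N := n.+1.

(** A simplex is a monotone path from the lowest corner of a cell to the highest; the permutation
    gives the step at which each coordinate is raised. *)
Definition kuhn_simplex : finType := ({ffun 'I_N -> 'I_m.+1} * 'S_N)%type.

Implicit Types (s : kuhn_simplex) (x : kuhn_simplex * 'I_N.+1).

(* Vertex [k] of [(v, t)] is [v + e_(t^-1 0) + ... + e_(t^-1 (k-1))]. *)
Definition vertex s (k : nat) : {ffun 'I_N -> nat} :=
  [ffun i => s.1 i + (s.2 i < k)].

(** Crossing the facet opposite vertex 0 moves the first step of the path to the end, which
    renumbers the steps cyclically; crossing the one opposite vertex [N] is the reverse move. *)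
Definition shift : 'S_N := perm (@ordS_inj N).

(* [pivot (s, k)] is the neighbor of [s] across its facet opposite to vertex
   [k], with the index of the opposite vertex there; pairs whose facet lies on
   the boundary of the cube are fixed. *)
Definition pivot x :=
  let: (v, t, k) := x in
  if k == 0 :> nat then
    let i0 := (t^-1)%g ord0 in
    if v i0 < m then
      ([ffun i => inord (v i + (i == i0))], (t * shift^-1)%g, ord_max)
    else x
  else if k == N :> nat then
    let i0 := (t^-1)%g ord_max in
    if 0 < v i0 then
      ([ffun i => inord (v i - (i == i0))], (t * shift)%g, ord0)
    else x
  else (v, (t * tperm (inord k.-1) (inord k))%g, k).

Lemma shift_max : shift ord_max = ord0.
Proof. by apply: val_inj; rewrite permE /= modnn. Qed.

Lemma shiftV0 : (shift^-1)%g ord0 = ord_max.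
Proof. by rewrite -shift_max permK. Qed.

Lemma val_shift (i : 'I_N) : i < n -> shift i = i.+1 :> nat.
Proof. by move=> ltin; rewrite permE /= modn_small. Qed.

Lemma val_shiftV (i : 'I_N) : 0 < i -> (shift^-1)%g i = i.-1 :> nat.
Proof.
move=> i_gt0; have lti : i.-1 < N by rewrite (leq_ltn_trans (leq_pred _)).
suff -> : i = shift (Ordinal lti) by rewrite permK val_shift /= -1?ltnS ?prednK.
by apply: ord_inj; rewrite val_shift /= ?prednK // -ltnS.
Qed.

Lemma pivotK : involutive pivot.
Proof.
case=> [[v t] k]; rewrite /pivot.
case: ifPn => [/eqP k0|k0].
  case: ifPn => [vm|nvm]; last by rewrite k0 eqxx /= (negbTE nvm).
  rewrite /= eqxx invMg permM invgK shift_max ffunE eqxx addn1.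
  rewrite inordK ?ltnS //= mulgKV; congr (_, _, _); last exact: val_inj.
  apply/ffunP => i; rewrite !ffunE inordK ?addnK ?inord_val //.
  by rewrite ltnS; case: eqVneq => [->|_]; rewrite ?addn1 // addn0 -ltnS.
case: ifPn => [/eqP kN|kN].
  case: ifPn => [v0|nv0]; last by rewrite (negbTE k0) kN eqxx (negbTE nv0).
  rewrite /= invMg permM shiftV0 ffunE eqxx subn1 mulgK.
  have lt_v (i : 'I_m.+1) : i.-1 < m.+1 by apply: leq_ltn_trans (leq_pred _) _.
  rewrite inordK // prednK // -ltnS ltn_ord.
  congr (_, _, _); last exact/val_inj/esym.
  apply/ffunP => i; rewrite !ffunE inordK.
    rewrite subnK ?inord_val //; by case: eqVneq => // ->.
  exact: leq_ltn_trans (leq_subr _ _) _.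
by rewrite (negbTE k0) (negbTE kN) -mulgA tperm2 mulg1.
Qed.

(** A cyclic move renumbers the shared vertices by one, down or up; exchanging the steps [k - 1] and
    [k] alters vertex [k] only. *)
Lemma pivot_vertex x : pivot x != x ->
  forall i : 'I_N.+1, i != x.2 ->
  exists2 j : 'I_N.+1, j != (pivot x).2 & vertex (pivot x).1 j = vertex x.1 i.
Proof.
case: x => [[v t] k]; rewrite /pivot /vertex /=.
case: ifPn => [/eqP k0|k0].
  case: ifPn => [vm _ i|_]; last by rewrite eqxx.
  rewrite -val_eqE /= k0 -lt0n => i_gt0.
  have lti : i.-1 < N by rewrite -ltnS prednK.
  exists (inord i.-1); first by rewrite -val_eqE /= inordK ?ltn_eqF // ltnW.
  apply/ffunP => j; rewrite !ffunE (inordK (ltnW lti)) /= permM.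
  have [->|jt] := eqVneq j ((t^-1)%g ord0).
    rewrite permKV shiftV0 i_gt0 inordK ?addn1 ?ltnS //.
    by rewrite ltnNge -ltnS lti addn0.
  have tj : 0 < t j.
    rewrite lt0n; apply: contraNneq jt => tj; apply/eqP.
    by apply: (@perm_inj _ t); rewrite permKV; apply: val_inj.
  rewrite addn0 inord_val val_shiftV //; congr (_ + nat_of_bool _).
  by rewrite -ltnS !prednK.
case: ifPn => [/eqP kN|kN].
  case: ifPn => [v0 _ i|_]; last by rewrite eqxx.
  rewrite -val_eqE /= kN => iN.
  have lti : i < N by rewrite ltn_neqAle iN -ltnS /=.
  exists (inord i.+1); first by rewrite -val_eqE /= inordK.
  apply/ffunP => j; rewrite !ffunE (inordK (lti : i.+1 < N.+1)) permM.
  have [->|jt] := eqVneq j ((t^-1)%g ord_max).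
    rewrite permKV shift_max /= [_ < i]ltnNge -ltnS lti addn0.
    rewrite inordK ?subnK // (leq_ltn_trans (leq_subr _ _)) //.
  have tj : t j < n.
    rewrite ltn_neqAle -[_ <= n]ltnS ltn_ord andbT.
    apply: contraNneq jt => tj; apply/eqP.
    by apply: (@perm_inj _ t); rewrite permKV; apply: val_inj.
  by rewrite subn0 inord_val val_shift // ltnS.
move=> _ i; rewrite -val_eqE => ik; exists i => //.
apply/ffunP => j; rewrite !ffunE permM; congr (_ + nat_of_bool _).
have ltk : k < N by rewrite ltn_neqAle kN -ltnS /=.
have ltk' : k.-1 < N by rewrite (leq_ltn_trans (leq_pred _)).
have kp : k.-1.+1 = k by rewrite prednK // lt0n.
case: tpermP => // ->; rewrite !inordK //.
  by rewrite kp [RHS]leq_eqVlt [_ == _ :> nat]eq_sym (negbTE ik).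
by rewrite kp [LHS]leq_eqVlt [_ == _ :> nat]eq_sym (negbTE ik).
Qed.

(** * Sperner colorings and the parity of their doors *)

Section Coloring.
Variable c : {ffun 'I_N -> nat} -> 'I_N.+1.
Hypothesis c_bottom : forall (p : {ffun 'I_N -> nat}) (i : 'I_N),
  p i = 0 -> c p <> i :> nat.
Hypothesis c_top : forall (p : {ffun 'I_N -> nat}) (i : 'I_N),
  p i = m.+1 -> (forall j : 'I_N, j < i -> p j <> m.+1) -> c p = i :> nat.

Definition door : {set kuhn_simplex * 'I_N.+1} :=
  [set x | rainbow_facet (fun k : 'I_N.+1 => c (vertex x.1 k)) x.2].

Lemma pivot_door : {in door, forall x, pivot x \in door}.
Proof.
move=> x Dx; have [->//|/pivot_vertex fx] := eqVneq (pivot x) x.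
move: Dx; rewrite !inE => /forallP Dx; apply/forallP => j.
have /existsP[i /andP[/fx[i' i'k <-] ci]] := Dx j.
by apply/existsP; exists i'; rewrite i'k.
Qed.

Lemma top_color s k (i0 : 'I_N) : vertex s k i0 = m.+1 ->
  exists i : 'I_N, [/\ c (vertex s k) = i :> nat, vertex s k i = m.+1 &
    forall j : 'I_N, j < i -> vertex s k j <> m.+1].
Proof.
move=> /eqP top0; pose top i := vertex s k i == m.+1.
case: (@arg_minnP _ i0 top (fun i => nat_of_ord i) top0) => i /eqP topi mini.
have ltopi (j : 'I_N) : j < i -> vertex s k j <> m.+1.
  by move=> ji /eqP/mini; rewrite leqNgt ji.
by exists i; rewrite (c_top topi ltopi).
Qed.

(** Vertex [k > 0] of this simplex is maximal exactly in the coordinates [i >= N - k], so [c_top]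
    gives it the color [N - k]. *)
Definition top_corner : kuhn_simplex * 'I_N.+1 :=
  ([ffun=> ord_max], perm (@rev_ord_inj N), ord0).

(* Such a door lies on an upper face, where the colors of the vertices 1, ..., N
   are nonincreasing, hence equal to N-1, ..., 0: this determines the simplex. *)
Lemma fixed_door0 v t : (v, t, ord0) \in door ->
    pivot (v, t, ord0) = (v, t, ord0) ->
  (v, t, ord0) = top_corner.
Proof.
rewrite inE => /forallP /= Ds; rewrite /pivot /=.
case: ifP => [_ [_ _] //|/negbT vm _].
pose i0 := (t^-1)%g ord0.
pose s : kuhn_simplex := (v, t).
have top0 k : 0 < k -> vertex s k i0 = m.+1.
  move=> k0; rewrite ffunE permKV k0 addn1; congr _.+1; apply/eqP.
  by rewrite eqn_leq -ltnS ltn_ord leqNgt.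
have vertexS k k' i : k <= k' -> vertex s k i = m.+1 -> vertex s k' i = m.+1.
  rewrite !ffunE => kk'; case: (ltnP (s.2 i) k) => [/leq_trans -> //|_].
  by rewrite addn0 => vi; have := ltn_ord (s.1 i); rewrite vi ltnn.
pose b j : nat := c (vertex s (N - j)).
(* A nondecreasing list of length [N] that contains [0, ..., N - 1] is that very list. *)
have bE : map b (iota 0 N) = iota 0 N.
  have iota_sub : {subset iota 0 N <= map b (iota 0 N)}.
    move=> j; rewrite mem_iota => /andP[_ jN].
    have /existsP[k /andP[k0 /eqP ck]] := Ds (Ordinal jN).
    have kN : k <= N by rewrite -ltnS.
    apply/mapP; exists (N - k).
      by rewrite mem_iota ltn_subrL /= andbT lt0n.
    by rewrite /b subKn.
  apply: (@sorted_eq _ leq leq_trans anti_leq _ _ _ (iota_sorted 0 N)).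
    apply: (@homo_sorted_in _ _ (fun j => j < N) b leq leq); last 2 first.
    - by apply/allP => j; rewrite mem_iota.
    - exact: iota_sorted.
    move=> j j' jN j'N jj'.
    have [|i [bi topi _]] := @top_color s (N - j') i0.
      by apply: top0; rewrite subn_gt0.
    have [|i' [bi' _ ltop]] := @top_color s (N - j) i0.
      by apply: top0; rewrite subn_gt0.
    rewrite /b bi bi' leqNgt; apply/negP => /ltop; apply.
    by apply: vertexS topi; rewrite leq_sub2l.
  have sz : size (map b (iota 0 N)) <= size (iota 0 N) by rewrite size_map.
  apply: uniq_perm; rewrite ?iota_uniq //.
    exact: leq_size_uniq (iota_uniq 0 N) iota_sub sz.
  by move=> j; have [_ ->] := uniq_min_size (iota_uniq 0 N) iota_sub sz.
have corner (j : 'I_N) : vertex s (N - j) j = m.+1 /\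
    forall j' : 'I_N, j' < j -> vertex s (N - j) j' <> m.+1.
  have bj : b j = j.
    have := congr1 (nth 0 ^~ j) bE.
    by rewrite (nth_map 0) ?size_iota // nth_iota // add0n.
  have [|i [bi topi ltop]] := @top_color s (N - j) i0.
    by apply: top0; rewrite subn_gt0.
  have ij : i = j by apply: ord_inj; rewrite -bi; exact: bj.
  by subst i.
(* Coordinate [j] is maximal at vertex [N - j], whence [v j = m] and [t j < N - j]. For [j < n] it
   is not maximal at vertex [N - (j + 1)], whose color is [j + 1]; this gives the converse bound on
   [t j]. *)
have vt (j : 'I_N) : v j = m :> nat /\ t j = rev_ord j.
  have [] := corner j; rewrite ffunE /=.
  have [tj|tj] := ltnP (t j) (N - j); last first.
    by rewrite addn0 => vj; have := ltn_ord (v j); rewrite vj ltnn.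
  rewrite addn1 => -[vj] _; split=> //; apply/val_inj/eqP.
  rewrite eqn_leq /= -ltnS -subSn ?ltn_ord // subSS tj /=.
  have [jn|jn] := ltnP j n; last first.
    by rewrite -subn_eq0 in jn; rewrite subSS (eqP jn).
  have [_ /(_ j)] := corner (Ordinal (jn : j.+1 < N)).
  rewrite /= ltnSn ffunE /= => /(_ isT); case: leqP => // _.
  by rewrite addn1 vj.
congr (_, _, _).
  by apply/ffunP => j; rewrite ffunE; apply: ord_inj; rewrite (vt j).1.
by apply/permP => j; rewrite permE (vt j).2.
Qed.

(** A facet opposite a middle vertex is never fixed, as a transposition is not the identity; a fixed
    one opposite vertex [N] lies on a lower face, where [c_bottom] excludes one of the required
    colors. *)
Lemma fixed_door x : x \in door -> pivot x = x -> x = top_corner.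
Proof.
case: x => [[v t] k] Dx px.
have [k0|k0] := eqVneq k ord0; first by subst k; exact: fixed_door0.
move: px; rewrite /pivot; rewrite -val_eqE in k0; rewrite (negbTE k0).
case: ifP => [kN|/negbT kN] /=; last first.
  case=> /(canRL (mulKg t)); rewrite mulVg => tp1.
  have := tpermL (inord k.-1 : 'I_N) (inord k); rewrite tp1 perm1.
  have kS : k.-1.+1 = k by rewrite prednK // lt0n.
  have kN' : k < N by rewrite ltn_neqAle kN -ltnS /=.
  move/(congr1 val) => /=; rewrite !inordK ?kS //; last exact: ltnW.
  by move/eqP; rewrite ltn_eqF ?kS.
case: ifP => [_ [_ _ k0']|/negbT]; first by rewrite -k0' in k0.
rewrite -eqn0Ngt => /eqP v0 _.
have := Dx; rewrite inE => /forallP/(_ ((t^-1)%g ord_max))/existsP[i /=].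
case/andP=> ik /eqP ci; case: (c_bottom _ ci).
rewrite ffunE v0 permKV /= ltnNge -ltnS ltn_neqAle -ltnS ltn_ord andbT.
by move: ik; rewrite -val_eqE /= (eqP kN) => ->.
Qed.

Lemma top_corner_door : top_corner \in door.
Proof.
rewrite inE; apply/forallP => j; apply/existsP; exists (inord (N - j)).
have ltNj : N - j < N.+1 by rewrite ltnS leq_subr.
rewrite -val_eqE /= inordK // -lt0n subn_gt0 ltn_ord; apply/eqP.
apply: c_top => [|i ij]; rewrite !ffunE permE /=.
  by rewrite subSS subSn ?ltnSn ?addn1 // -ltnS.
rewrite [_ < _]ltnNge leq_sub2l // addn0 => /eqP.
by rewrite ltn_eqF.
Qed.

Lemma full_cell : exists v : {ffun 'I_N -> 'I_m.+1}, forall j : 'I_N.+1,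
  exists p : {ffun 'I_N -> nat}, (forall i, v i <= p i <= (v i).+1) /\ c p = j.
Proof.
pose full s := [forall j : 'I_N.+1, [exists k : 'I_N.+1, c (vertex s k) == j]].
suff /existsP[s /forallP fs] : [exists s, full s].
  exists s.1 => j; have /existsP[k /eqP ck] := fs j.
  exists (vertex s k); split=> // i; rewrite ffunE leq_addr.
  by rewrite -[leqRHS]addn1 leq_add2l leq_b1.
have : odd #|door|.
  rewrite (odd_card_involution pivot_door) => [|x _]; last exact: pivotK.
  suff -> : [set x in door | pivot x == x] = [set top_corner] by rewrite cards1.
  apply/setP => x; rewrite inE in_set1; apply/andP/eqP => [[Dx /eqP]|->].
    exact: fixed_door.
  by split; [exact: top_corner_door|rewrite /pivot /= ffunE ltnn].
apply: contraTT => /existsPn nofull.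
have -> : #|door| = \sum_(s : kuhn_simplex)
    #|[set k | rainbow_facet (fun k : 'I_N.+1 => c (vertex s k)) k]|.
  rewrite -sum1_card; under [RHS]eq_bigr do rewrite -sum1_card.
  rewrite pair_big_dep /=; apply: eq_bigl => -[s k].
  by rewrite !inE.
rewrite -dvdn2; apply: dvdn_sum => s _; rewrite dvdn2.
apply: even_rainbow_facets.
have /forallPn[j /existsPn nj] := nofull s.
by exists j.
Qed.
End Coloring.

End Kuhn.

From mathcomp Require Import all_classical all_reals all_analysis.
From mathcomp Require Import ring lra.

Import Order.TTheory GRing.Theory Num.Theory.
Import numFieldNormedType.Exports.

Local Open Scope classical_set_scope.
Local Open Scope ring_scope.

(** * The Poincare-Miranda theorem *)

Lemma row_norm_le (R : realType) (n : nat) (v : 'rV[R]_n) (e : R) : 0 <= e ->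
  (forall i, `|v ord0 i| <= e) -> `|v| <= e.
Proof.
move=> e0 ve; rewrite [leLHS]/Num.norm /= mx_normrE; apply: bigmax_le => //.
by case=> i j _ /=; rewrite ord1.
Qed.

Section Grid.
Variables (R : realType) (n : nat) (h : 'rV[R]_n.+1 -> 'rV[R]_n.+1) (B : R).
Hypothesis B_ge0 : 0 <= B.
Hypothesis h_left : forall (y : 'rV[R]_n.+1) i,
  y ord0 i = - B -> 0 <= h y ord0 i.
Hypothesis h_right : forall (y : 'rV[R]_n.+1) i,
  y ord0 i = B -> h y ord0 i <= 0.
Variable m : nat.

Implicit Types (p : {ffun 'I_n.+1 -> nat}) (i : 'I_n.+1).

Let grid p : 'rV[R]_n.+1 := \row_i (- B + 2 * B * ((p i)%:R / m.+1%:R)).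

(** Color [i] certifies that component [i] of [h] is nonpositive, the last color that all components
    are nonnegative. The first test enforces [color_top], the guard [0 < p i] enforces
    [color_bottom], and [h_left] covers the coordinates that this guard rejects. *)
Let color p : 'I_n.+2 :=
  if [pick i | (p i == m.+1) &&
               [forall j : 'I_n.+1, (j < i)%N ==> (p j != m.+1)]]
    is Some i then widen_ord (leqnSn _) i
  else if [pick i | (0 < p i)%N && (h (grid p) ord0 i < 0)] is Some i
    then widen_ord (leqnSn _) i
  else ord_max.

Let color_bottom p i : p i = 0%N -> color p <> i :> nat.
Proof.
rewrite /color => pi0; case: pickP => [j /andP[/eqP pj _] /= ji|_].
  by rewrite (ord_inj ji) pi0 in pj.
case: pickP => [j /andP[pj _] /= ji|_ /= ni].
  by rewrite (ord_inj ji) pi0 in pj.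
by have := ltn_ord i; rewrite -ni ltnn.
Qed.

Let color_top p i : p i = m.+1 ->
    (forall j : 'I_n.+1, (j < i)%N -> p j <> m.+1) ->
  color p = i :> nat.
Proof.
rewrite /color => pi ltp.
case: pickP => [j /andP[/eqP pj /forallP ltj] /=|/(_ i)].
  case: (ltngtP j i) => // [/ltp//|ij].
  by have := ltj i; rewrite ij pi eqxx.
rewrite pi eqxx /= => /negbT/forallPn[j]; rewrite negb_imply => /andP[/ltp pj].
by rewrite negbK => /eqP.
Qed.

Let color_le0 p i : color p = i :> nat -> h (grid p) ord0 i <= 0.
Proof.
rewrite /color; case: pickP => [j /andP[/eqP pj _] /= /ord_inj <-|_].
  by apply: h_right; rewrite mxE pj divff ?pnatr_eq0 //; ring.
case: pickP => [j /andP[_ /ltW hj] /= /ord_inj <- //|_ /= ni].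
by have := ltn_ord i; rewrite -ni ltnn.
Qed.

Let color_ge0 p i : color p = n.+1 :> nat -> 0 <= h (grid p) ord0 i.
Proof.
rewrite /color; case: pickP => [j _ /= jn|_].
  by have := ltn_ord j; rewrite jn ltnn.
case: pickP => [j _ /= jn|/(_ i)/negbT].
  by have := ltn_ord j; rewrite jn ltnn.
rewrite negb_and -leqNgt leqn0 -leNgt => /orP[/eqP pi0 _|//].
by apply: h_left; rewrite mxE pi0; ring.
Qed.

(** In a cell with all colors, with lowest corner [y], the corner of color [i] serves as [z] and
    that of the last color as [w]; [2 * B / (m + 1)] is the mesh. *)
Lemma approximate_zero : exists y : 'rV[R]_n.+1, `|y| <= B /\
  forall i, exists z w, [/\ `|z - y| <= 2 * B / m.+1%:R, h z ord0 i <= 0,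
    `|w - y| <= 2 * B / m.+1%:R & 0 <= h w ord0 i].
Proof.
have [v full_v] := full_cell color_bottom color_top.
pose y := grid [ffun i => v i : nat].
have m0 : 0 < m.+1%:R :> R by rewrite ltr0n.
have near_vertex p : (forall i, v i <= p i <= (v i).+1)%N ->
    `|grid p - y| <= 2 * B / m.+1%:R.
  move=> vp; apply: row_norm_le => [|i]; first by rewrite divr_ge0 ?mulr_ge0.
  have /andP[vpi piv] := vp i.
  rewrite !mxE !ffunE -(subnKC vpi) natrD.
  rewrite (_ : _ - _ = 2 * B / m.+1%:R * (p i - v i)%N%:R); last by ring.
  rewrite ger0_norm ?mulr_ge0 ?invr_ge0 //.
  by rewrite ler_piMr ?divr_ge0 ?mulr_ge0 // lern1 leq_subLR addn1.
exists y; split.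
  apply: row_norm_le => // i; rewrite !mxE ffunE ler_norml.
  have q0 : 0 <= (v i)%:R / m.+1%:R :> R by rewrite divr_ge0.
  have q1 : (v i)%:R / m.+1%:R <= 1 :> R.
    by rewrite ler_pdivrMr // mul1r ler_nat ltnW.
  move: ((v i)%:R / _) q0 q1 => q q0 q1.
  have Bq0 : 0 <= B * q by rewrite mulr_ge0.
  have Bq1 : B * q <= B by rewrite ler_piMr.
  by apply/andP; split; rewrite -mulrA; lra.
move=> i.
have [z [vz cz]] := full_v (widen_ord (leqnSn _) i).
have [w [vw cw]] := full_v ord_max.
exists (grid z), (grid w); split; try exact: near_vertex.
  by apply: color_le0; rewrite cz.
by apply: color_ge0; rewrite cw.
Qed.

End Grid.

(** Let the mesh tend to 0. At a cluster point [p] of the approximate zeros, a nonzero component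
    would keep its strict sign near [p], whereas small cells near [p] show both weak signs. *)
Lemma poincare_miranda (R : realType) (n : nat)
    (h : 'rV[R]_n -> 'rV[R]_n) (B : R) :
    0 <= B -> continuous h ->
    (forall (y : 'rV[R]_n) i, y ord0 i = - B -> 0 <= h y ord0 i) ->
    (forall (y : 'rV[R]_n) i, y ord0 i = B -> h y ord0 i <= 0) ->
  exists p, h p = 0.
Proof.
case: n h => [|n] h B0 hc hl hr; first by exists 0; apply/rowP => -[].
have [y yP] := choice (approximate_zero B0 hl hr).
have cb : compact [set v : 'rV[R]_n.+1 | `|v| <= B].
  apply: bounded_closed_compact.
    exists B; split; first exact: num_real.
    by move=> M BM v /= vB; apply: le_trans vB (ltW BM).
  rewrite -[X in closed X]/((fun v : 'rV[R]_n.+1 => `|v|) @^-1`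
    [set x | x <= B]).
  apply: closed_comp; last exact: closed_le.
  by move=> ? _; exact: norm_continuous.
have [|p [_ clp]] := cb (y @ \oo) _.
  by exists 0%N => // k _; exact: (yP k).1.
exists p; apply/rowP => i; rewrite [RHS]mxE.
(* Some [y k] is within [e / 2] of [p] with mesh below [e / 2], so all points within one mesh of it
   lie in [A]. *)
have near_p (A : set 'rV[R]_n.+1) : nbhs p A -> exists k, forall z,
    `|z - y k| <= 2 * B / k.+1%:R -> A z.
  move=> /nbhs_ballP[e /= e0 eA].
  have [K _ Ke] : \forall k \near \oo, 2 * B / k.+1%:R < e / 2.
    near=> k; rewrite ltr_pdivrMr // mulrAC ltr_pdivlMr // -ltr_pdivrMl //.
    rewrite (@lt_trans _ _ k%:R) ?ltr_nat //.
    by near: k; exact: nbhs_infty_gtr.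
  have [||_ [[k /= Kk <-] ykp]] :=
      clp [set y k | k in [set k | K <= k]%N] (ball p (e / 2)).
  - by exists K => // k /= Kk; exists k.
  - by apply: nbhsx_ballx; rewrite divr_gt0.
  exists k => z zk; apply: eA; apply: (ball_split ykp).
  rewrite -ball_normE /= distrC; apply: le_lt_trans zk _; exact: Ke.
have hi_cont : {for p, continuous (fun v => h v ord0 i)}.
  apply: (@continuous_comp _ _ _ h (fun v : 'rV[R]_n.+1 => v ord0 i) p).
    exact: hc.
  exact: coord_continuous.
apply/eqP; rewrite eq_le; apply/andP; split; rewrite leNgt; apply/negP => hp.
  have [k nk] := near_p [set v | 0 < h v ord0 i] (hi_cont _ (lt_nbhsr hp)).
  have [z [_ [/nk /= + hz _ _]]] := (yP k).2 i.
  by rewrite ltNge hz.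
have [k nk] := near_p [set v | h v ord0 i < 0] (hi_cont _ (lt_nbhsl hp)).
have [_ [w [_ _ /nk /= + hw]]] := (yP k).2 i.
by rewrite ltNge hw.
Unshelve. all: by end_near. Qed.

(** * Radial retraction onto a convex set *)

Lemma convex_set_segment (R : numDomainType) (V : lmodType R) (C : set V) :
  convex_set C -> forall a b t, C a -> C b -> 0 <= t -> t <= 1 ->
  C (t *: a + (1 - t) *: b).
Proof.
move=> convC a b t Ca Cb t0 t1.
have t01 : Itv.spec (@Itv.num_sem R) (Itv.Real `[0%Z, 1%Z]) t.
  by rewrite /= /Itv.num_sem /= in_itv /= t0 t1 realE t0.
by have := convC a b (Itv.mk t01) (mem_set Ca) (mem_set Cb); rewrite inE.
Qed.

Section RadialRetraction.
Variables (R : realType) (V : normedModType R) (C : set V) (x0 : V) (rho : R).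
Hypotheses (C_closed : closed C) (C_convex : convex_set C) (rho_gt0 : 0 < rho).
Hypothesis C_ball : forall u, `|u| <= rho -> C (x0 + u).

Definition scales (w : V) : set R := [set l | 1 <= l /\ C (x0 + l^-1 *: w)].

(** The maximum of 1 and the Minkowski functional of [C - x0]; the cutoff at 1 makes [radial] the
    identity on [C]. *)
Definition gauge1 (w : V) : R := inf (scales w).

Lemma scales_nonempty w : scales w !=set0.
Proof.
exists (1 + `|w| / rho); have w0 : 0 <= `|w| / rho by rewrite divr_ge0 // ltW.
split; first by rewrite lerDl.
apply: C_ball; rewrite normrZ normfV [X in X^-1]ger0_norm ?addr_ge0 //.
rewrite mulrC ler_pdivrMr ?ltr_pwDl // mulrDr mulr1 mulrCA divff ?gt_eqF //.
by rewrite mulr1 lerDr ltW.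
Qed.

Let scales_lbound w : has_lbound (scales w).
Proof. by exists 1 => l []. Qed.

Let has_inf_scales w : has_inf (scales w).
Proof. by split; [exact: scales_nonempty|exact: scales_lbound]. Qed.

Let gauge1_ge1 w : 1 <= gauge1 w.
Proof. by apply: lb_le_inf; [exact: scales_nonempty|move=> l []]. Qed.

Let gauge1_gt0 w : 0 < gauge1 w.
Proof. exact: lt_le_trans ltr01 (gauge1_ge1 w). Qed.

Let scaling_continuous w (l : R) : 0 < l ->
  {for l, continuous (fun l : R => x0 + l^-1 *: w)}.
Proof.
move=> l0; apply: cvgD; first exact: cvg_cst.
apply: cvgZr_tmp.
by apply: cvgV => //; rewrite gt_eqF.
Qed.

(** The infimum is attained because [C] is closed: otherwise all scales close to it would lead
    outside [C]. *)
Lemma scales_gauge1 w : scales w (gauge1 w).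
Proof.
split=> //; apply: contrapT => notC.
have : nbhs (x0 + (gauge1 w)^-1 *: w) (~` C).
  by apply: open_nbhs_nbhs; split=> //; exact: closed_openC.
move/(scaling_continuous (gauge1_gt0 w))/nbhs_ballP => [e /= e0 eC].
have [l wl lq] := inf_adherent e0 (has_inf_scales w).
apply: (eC l); last exact: wl.2.
rewrite -ball_normE /= distrC ger0_norm ?ltrBlDl // subr_ge0.
exact: ge_inf.
Qed.

(** With [q = gauge1 w] and [d = |u| / rho], the point [x0 + (w + u) / (q + d)] is a convex
    combination of [x0 + w / q] and [x0 + u / d], both in [C]. This makes [gauge1] Lipschitz with
    constant [1 / rho]. *)
Let gauge1D w u : gauge1 (w + u) <= gauge1 w + `|u| / rho.
Proof.
have [->|u0] := eqVneq u 0; first by rewrite addr0 normr0 mul0r addr0.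
have nu0 : 0 < `|u| by rewrite normr_gt0.
apply: ge_inf => //.
have [_ Cq] := scales_gauge1 w.
have Cd : C (x0 + (`|u| / rho)^-1 *: u).
  apply: C_ball; rewrite normrZ normfV gtr0_norm ?divr_gt0 // invf_div.
  by rewrite divfK ?gt_eqF.
have d0 : 0 < `|u| / rho by rewrite divr_gt0.
move: (gauge1 w) (gauge1_ge1 w) (gauge1_gt0 w) (`|u| / rho) Cq Cd d0.
move=> q q1 q0 d Cq Cd d0; have qd0 : 0 < q + d by rewrite addr_gt0.
split; first by rewrite (le_trans q1) // lerDl ltW.
have -> : x0 + (q + d)^-1 *: (w + u) =
    (q / (q + d)) *: (x0 + q^-1 *: w) + (1 - q / (q + d)) *: (x0 + d^-1 *: u).
  rewrite !scalerDr addrACA -scalerDl [_ / _ + _]addrC subrK scale1r !scalerA.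
  by congr (_ + (_ *: _ + _ *: _)); field; rewrite !gt_eqF.
apply: (convex_set_segment C_convex) => //; first by rewrite divr_ge0 ?ltW.
by rewrite ler_pdivrMr // mul1r lerDl ltW.
Qed.

Lemma gauge1_continuous : continuous gauge1.
Proof.
move=> w; apply/cvgrPdist_lt => e e0.
have lip v v' : gauge1 v - gauge1 v' <= `|v - v'| / rho.
  by rewrite lerBlDl -{1}(subrK v' v) [v - v' + _]addrC gauge1D.
near=> w'.
have ww' : `|w - w'| / rho < e.
  rewrite ltr_pdivrMr //; near: w'.
  by apply: cvgr_dist_lt; rewrite ?mulr_gt0.
rewrite ltr_norml; apply/andP; split; last exact: le_lt_trans (lip _ _) ww'.
rewrite ltrNl opprB; apply: le_lt_trans (lip _ _) _.
by rewrite distrC.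
Unshelve. all: by end_near. Qed.

Definition radial (y : V) : V := x0 + (gauge1 (y - x0))^-1 *: (y - x0).

Lemma radial_continuous : continuous radial.
Proof.
move=> y.
have sub_cont : (y' - x0) @[y' --> y] --> y - x0.
  by apply: cvgB; [exact: cvg_id|exact: cvg_cst].
apply: cvgD; first exact: cvg_cst.
apply: cvgZ => //; apply: cvgV; first by rewrite gt_eqF.
exact: (cvg_comp _ _ sub_cont (@gauge1_continuous _)).
Qed.

Lemma radial_mem y : C (radial y).
Proof. exact: (scales_gauge1 _).2. Qed.

Lemma sub_radial y :
  y - radial y = (gauge1 (y - x0) - 1) *: (radial y - x0).
Proof.
rewrite /radial [x0 + _ - x0]addrC addKr scalerA mulrBl mul1r divff ?gt_eqF //.
by rewrite scalerBl scale1r opprD addrA.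
Qed.

(** If [radial y] were interior while [gauge1 (y - x0) > 1], a scale slightly below this infimum
    would still lead into [C]. *)
Lemma radial_boundary y : radial y = y \/
  1 < gauge1 (y - x0) /\ boundary C (radial y).
Proof.
have [q1|q1] := leP (gauge1 (y - x0)) 1.
  left; have -> : radial y = x0 + (y - x0); last by rewrite addrC subrK.
  have qE : gauge1 (y - x0) = 1 by apply/eqP; rewrite eq_le q1 /=.
  by rewrite /radial qE invr1 scale1r.
right; split=> //; split; first exact/subset_closure/radial_mem.
move=> /(scaling_continuous (gauge1_gt0 (y - x0)))/nbhs_ballP[e /= e0 eC].
set q := gauge1 (y - x0) in q1 eC.
(* This scale is at least 1, below [q], and within [e] of [q]. *)
pose l := Num.max 1 (q - e / 2).
have lq : l < q by rewrite gt_max q1 ltrBlDr ltrDl divr_gt0.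
have : q <= l; last by rewrite leNgt lq.
apply: ge_inf => //; split; first by rewrite le_max lexx.
apply: eC; rewrite -ball_normE /= gtr0_norm ?subr_gt0 // ltrBlDr -ltrBlDl.
rewrite lt_max; apply/orP; right; lra.
Qed.

End RadialRetraction.

(** * Outer normals and the zero of [f] *)

Lemma inner_normal_gt0 (R : realType) (N : nat) (C : set 'rV[R]_N)
    (nu : 'rV[R]_N -> 'rV[R]_N) (x0 : 'rV[R]_N) (rho : R) :
  0 < rho -> (forall u, `|u| <= rho -> C (x0 + u)) ->
  outer_normal_field C nu ->
  forall x, boundary C x -> 0 < inner (x - x0) (nu x).
Proof.
move=> rho0 C_ball [nu1 nuC] x bx.
have nn : inner (nu x) (nu x) = 1.
  have := nu1 _ bx; rewrite /unit_sphere /= => sq1.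
  have := sqr_sqrtr (_ : 0 <= inner (nu x) (nu x)).
  rewrite sq1 expr1n => -> //.
  by apply: sumr_ge0 => i _; rewrite -expr2 sqr_ge0.
(* The factor [t] keeps [x0 + t nu(x)] in the ball around [x0]. The normal inequality at that point,
   with [nu x] a unit vector, gives [<x - x0, nu x> >= t]. *)
pose t := rho / (1 + `|nu x|).
have t0 : 0 < t by rewrite divr_gt0 // ltr_pwDl.
have Cu : C (x0 + t *: nu x).
  apply: C_ball; rewrite normrZ gtr0_norm // /t mulrAC ler_pdivrMr ?ltr_pwDl //.
  by rewrite mulrDr mulr1 lerDr ltW.
have := nuC _ _ bx Cu.
have -> : inner (x0 + t *: nu x - x) (nu x) =
    t * inner (nu x) (nu x) - inner (x - x0) (nu x).
  rewrite /inner mulr_sumr -sumrB; apply: eq_bigr => i _; rewrite !mxE; ring.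
by rewrite nn mulr1 subr_le0; apply: lt_le_trans.
Qed.

Theorem theorem2p4 (R : realType) (N : nat) (C : set 'rV[R]_N)
    (f : 'rV[R]_N -> 'rV[R]_N)
    (C_nonempty : C !=set0) (C_closed : closed C) (C_bounded : bounded_set C)
    (C_convex : convex_set C) (C_interior : interior C !=set0)
    (f_continuous : {within C, continuous f})
    (f_inward : exists nu : 'rV[R]_N -> 'rV[R]_N,
       outer_normal_field C nu /\
       forall x, boundary C x -> inner (f x) (nu x) <= 0) :
  exists z : 'rV[R]_N,
    [/\ C z, ode_solution_in C f (fun=> z) & f z = 0].
Proof.
have [x0 /nbhs_ballP[e /= e0 eC]] := C_interior.
have [nu [nuC f_nu]] := f_inward.
have rho0 : 0 < e / 2 by rewrite divr_gt0.
have C_ball u : `|u| <= e / 2 -> C (x0 + u).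
  move=> ue; apply: eC; rewrite -ball_normE /= opprD addNKr normrN.
  by apply: le_lt_trans ue _; rewrite ltr_pdivrMr // ltr_pMr // ltr1n.
pose r := radial C x0.
have rC y : C (r y) := radial_mem C_closed rho0 C_ball y.
suff [z Cz fz] : exists2 z, C z & f z = 0.
  by exists z; split=> // t; split=> //; rewrite fz; exact: is_derive_cst.
(* [f] is continuous only within [C], but [r] takes its values there. *)
have fr_cont : continuous (f \o r).
  move=> y.
  have /subspace_continuousP/(_ (r y) (rC y)) := f_continuous.
  apply: cvg_comp => A /= CA.
  have rA : \forall y' \near y, C (r y') -> A (r y').
    exact: radial_continuous C_closed C_convex rho0 C_ball y _ CA.
  by near=> y'; have /(_ (rC y')) : C (r y') -> A (r y') by near: y'.
have C_compact : compact C by exact: bounded_closed_compact.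
have [M [_ fM]] := compact_bounded (continuous_compact f_continuous C_compact).
have [K [_ CK]] := C_bounded.
(* Boundedness is given for numbers strictly above [M] and [K], hence the [+ 1]; the maximum with 0
   makes the size of the box nonnegative. *)
pose M1 := Num.max 0 (M + 1); pose K1 := Num.max 0 (K + 1).
have coord_le (v : 'rV[R]_N) i : `|v ord0 i| <= `|v|.
  rewrite [leRHS]/Num.norm /= mx_normrE.
  by apply: (le_bigmax _ (fun ij => `|v ij.1 ij.2|) (ord0, i)).
have f_le y i : `|f (r y) ord0 i| <= M1.
  apply: le_trans (coord_le _ _) _; rewrite le_max; apply/orP; right.
  by apply: (fM (M + 1)); [rewrite ltrDl|exists (r y)].
have r_le y i : `|r y ord0 i| <= K1.
  apply: le_trans (coord_le _ _) _; rewrite le_max; apply/orP; right.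
  by apply: (CK (K + 1)); [rewrite ltrDl|exact: rC].
pose h y := f (r y) + r y - y.
have [p hp] : exists p, h p = 0.
  (* The coordinates of [f (r y) + r y] are at most [M1 + K1] in absolute value, so on the faces of
     this box the term [- y] decides the sign. *)
  apply: (@poincare_miranda _ _ h (M1 + K1)).
  - by rewrite addr_ge0 // le_max lexx.
  - move=> y; apply: (@cvgB _ _ _ (nbhs y) _ _ id); last exact: cvg_id.
    apply: (@cvgD _ _ _ (nbhs y) _ (f \o r) r); first exact: fr_cont.
    exact: radial_continuous rho0 C_ball _.
  - move=> y i yi; have := f_le y i; have := r_le y i.
    by rewrite !mxE yi !ler_norml => /andP[? ?] /andP[? ?]; lra.
  - move=> y i yi; have := f_le y i; have := r_le y i.
    by rewrite !mxE yi !ler_norml => /andP[? ?] /andP[? ?]; lra.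
(* [h p = 0] says that [f (r p) = p - r p], which is radial. *)
have frp : f (r p) = (gauge1 C x0 (p - x0) - 1) *: (r p - x0).
  rewrite -(sub_radial rho0 C_ball); apply/eqP; rewrite -subr_eq0 opprB addrA.
  exact/eqP.
exists (r p); first exact: rC.
have [rp|[q1 bp]] := radial_boundary C_closed rho0 C_ball p.
  by move: hp; rewrite /h /r rp addrK.
have := f_nu _ bp; rewrite -/r frp.
have -> (a : R) (u v : 'rV[R]_N) : inner (a *: u) v = a * inner u v.
  by rewrite /inner mulr_sumr; apply: eq_bigr => i _; rewrite mxE mulrA.
rewrite leNgt mulr_gt0 ?subr_gt0 //.
exact: (inner_normal_gt0 rho0 C_ball nuC bp).
Unshelve. all: by end_near. Qed.
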